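(* Let $\mu\ge2$ and consider either of the following families of functions on $\mathbb{R}^2$ with coordinates $(x,y)$ and boundary line $\{x=0\}$, with parameter $\lambda=(\lambda_1,\dots,\lambda_\mu)\in\mathbb{R}^\mu$, for any choice of the sign $\pm$: $$B_\mu:\quad f_\lambda(x,y)=x^\mu\pm y^2+\lambda_1x^{\mu-1}+\dots+\lambda_\mu,$$ $$C_\mu:\quad f_\lambda(x,y)=xy\pm y^\mu+\lambda_1y^{\mu-1}+\dots+\lambda_\mu.$$ Let $\Sigma\subset\mathbb{R}^\mu$ be the real discriminant variety of the family. Then every connected component of $\mathbb{R}^\mu\setminus\Sigma$ is contractible.
   Context: These families are the miniversal deformations of the real simple boundary function singularities of types $B_\mu$ and $C_\mu$ in two variables, where the boundary is the line $\{x=0\}\subset\mathbb{R}^2$. Discriminant: a parameter $\lambda\in\mathbb{R}^\mu$ is non-singular if (i) $0$ is a regular value of $f_\lambda:\mathbb{R}^2\to\mathbb{R}$, and (ii) the zero level set $f_\lambda^{-1}(0)$ is transversal to the boundary $\{x=0\}$. The real discriminant variety $\Sigma\subset\mathbb{R}^\mu$ is the set of all parameters that are not non-singular. *)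

(* Defs.v *)
From HB Require Import structures.
From mathcomp Require Import all_boot all_order all_algebra.
From mathcomp Require Import all_classical all_reals all_analysis.
Import Order.TTheory GRing.Theory Num.Theory.
Import numFieldNormedType.Exports.

Set Implicit Arguments.
Unset Strict Implicit.
Unset Printing Implicit Defensive.

Local Open Scope classical_set_scope.
Local Open Scope ring_scope.

(* The entry [l ord0 i] is the parameter lambda_(i+1), whence the exponent
   mu - (i+1); the sign is (-1) ^+ s with s : bool. *)
Definition B_family (R : realType) (mu : nat) (s : bool) (l : 'rV[R]_mu)
    (p : R * R) : R :=
  p.1 ^+ mu + (-1) ^+ s * p.2 ^+ 2
  + \sum_(i < mu) l ord0 i * p.1 ^+ (mu - i.+1).

Definition C_family (R : realType) (mu : nat) (s : bool) (l : 'rV[R]_mu)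
    (p : R * R) : R :=
  p.1 * p.2 + (-1) ^+ s * p.2 ^+ mu
  + \sum_(i < mu) l ord0 i * p.2 ^+ (mu - i.+1).

(* ['d g p] is the Frechet differential; it is only meaningful for
   differentiable g, which is the case of the polynomial functions above. *)
Definition zero_regular_value (R : realType) (g : R * R -> R) : Prop :=
  forall p : R * R, g p = 0 -> forall c : R, exists v : R * R, 'd g p v = c.

(* At a common point p, the tangent spaces ker ('d g p) of the level set and
   {v | v.1 = 0} of the boundary span the plane. The kernel is the tangent space
   of the level set because this is used jointly with [zero_regular_value]. *)
Definition transversal_to_boundary (R : realType) (g : R * R -> R) : Prop :=
  forall p : R * R, g p = 0 -> p.1 = 0 ->
  forall w : R * R, exists u v : R * R,
    [/\ 'd g p u = 0, v.1 = 0 & w = u + v].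

Definition nonsingular (R : realType) (mu : nat)
    (f : 'rV[R]_mu -> R * R -> R) (l : 'rV[R]_mu) : Prop :=
  zero_regular_value (f l) /\ transversal_to_boundary (f l).

Definition discriminant (R : realType) (mu : nat)
    (f : 'rV[R]_mu -> R * R -> R) : set 'rV[R]_mu :=
  [set l | ~ nonsingular f l].

(* The subspace A is nonempty and its identity map is homotopic, within A, to a
   constant map; continuity is for the subspace topology of A x [0, 1]. *)
Definition contractible (R : realType) (T : topologicalType) (A : set T) : Prop :=
  exists (a0 : T) (H : T * R -> T),
    [/\ A a0,
        {within A `*` [set t : R | 0 <= t <= 1], continuous H},
        forall a t, A a -> 0 <= t <= 1 -> A (H (a, t)),
        forall a, A a -> H (a, 0) = a &
        forall a, A a -> H (a, 1) = a0].
Arguments contractible R {T} A.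

(* Main.v *)
Require Import Defs.
From mathcomp Require Import all_boot all_order all_algebra.
From mathcomp Require Import all_classical all_reals all_analysis.
From mathcomp Require Import polyrcf ring lra.
Import Order.TTheory GRing.Theory Num.Theory.
Import numFieldNormedType.Exports.

Set Implicit Arguments.
Unset Strict Implicit.
Unset Printing Implicit Defensive.

Local Open Scope classical_set_scope.
Local Open Scope ring_scope.

(** Both families reduce to one statement about univariate polynomials. Attach
    to a parameter l the monic polynomial
      p = X^mu + e l_1 X^(mu-1) + ... + e l_mu,
    where e = 1 for B_mu and e is the sign of y^mu for C_mu, so that f_l is
    p(x) +- y^2, respectively xy + e p(y). In either case l is non-singular if
    and only if the real roots of p are simple and nonzero
    ([nonsingular_B], [nonsingular_C]), but for exchanged reasons: for B_mu a
    multiple root is a critical point and a zero root a tangency with the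
    boundary; for C_mu a multiple root is a tangency and a zero root a
    critical point.

    Such a polynomial factors uniquely as p = (X - x_1) ... (X - x_k) q with
    x_1 < ... < x_k nonzero and q monic without real root, hence q > 0
    everywhere. Fixing k and the signs of the x_i, the data (x_1, ..., x_k, q)
    range over a convex set. So the polynomials with prescribed signs of roots
    form a stratum which is contracted to any of its points p0 by moving the
    x_i and q along straight lines to those of p0 ([deform]).

    What remains is that the factorization depends continuously on p
    ([cvg_real_roots]). This gives the continuity of the contraction, and also
    shows that the signs of the roots are locally constant; hence a connected
    component lies in one stratum, and since a stratum is path-connected they
    coincide ([componentE]).

    Continuity of the factorization is proved by splitting off one root at a
    time ([cvg_root_factor]). A simple real root of the limit persists, by the
    intermediate value theorem, and the nearest real root converges to it
    ([cvg_nearest_root]); the quotient by the corresponding linear factor then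
    converges too ([coef_cvg_divXsubC]). When the roots of the limit are
    exhausted, the remaining quotient is close to a polynomial without real
    roots, so it has none itself ([near_rootless]): no root can appear from
    nowhere. *)

(** * Parameters as monic polynomials *)

Section PolyOfParam.
Variables (R : realType) (mu : nat).
Implicit Types (e : R) (l : 'rV[R]_mu).

(** The factor e serves to divide the C_mu family by the sign of y^mu. When
    e * e = 1, this is a bijection from parameters to monic polynomials of
    degree mu, with inverse [param_of e]. *)
Definition poly_of e l : {poly R} :=
  'X^mu + \sum_(i < mu) (e * l ord0 i) *: 'X^(mu - i.+1).

Definition param_of e (p : {poly R}) : 'rV[R]_mu :=
  \row_i (e * p`_(mu - i.+1)).

Lemma coef_poly_of e l (i : 'I_mu) :
  (poly_of e l)`_(mu - i.+1) = e * l ord0 i.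
Proof.
rewrite coefD coefXn coef_sum.
have im : (mu - i.+1 < mu)%N by rewrite ltn_subrL (leq_ltn_trans _ (ltn_ord i)).
rewrite (ltn_eqF im) add0r (bigD1 i)//= coefZ coefXn eqxx mulr1.
rewrite big1 ?addr0// => j ji; rewrite coefZ coefXn.
case: eqP => [|_]; last by rewrite mulr0.
move/(congr1 (fun k => mu - k)%N); rewrite !subKn ?ltn_ord// => -[ij].
by case/eqP: ji; apply/val_inj.
Qed.

Lemma size_poly_of_sum e l :
  (size (\sum_(i < mu) (e * l ord0 i) *: 'X^(mu - i.+1) : {poly R})%R <= mu)%N.
Proof.
apply: (leq_trans (size_sum _ _ _)); apply/bigmax_leqP => i _.
rewrite (leq_trans (size_scale_leq _ _))// size_polyXn.
by rewrite ltn_subrL (leq_ltn_trans _ (ltn_ord i)).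
Qed.

Lemma size_poly_of e l : size (poly_of e l) = mu.+1.
Proof. by rewrite size_polyDl size_polyXn// ltnS size_poly_of_sum. Qed.

Lemma monic_poly_of e l : poly_of e l \is monic.
Proof.
rewrite monicE lead_coefDl ?lead_coefXn// size_polyXn ltnS.
exact: size_poly_of_sum.
Qed.

Lemma poly_ofK e : e * e = 1 -> cancel (poly_of e) (param_of e).
Proof.
by move=> ee l; apply/rowP => i; rewrite mxE coef_poly_of mulrA ee mul1r.
Qed.

Lemma param_ofK e p : e * e = 1 -> p \is monic -> size p = mu.+1 ->
  poly_of e (param_of e p) = p.
Proof.
move=> ee pm sp; apply/polyP => j.
have [jm|jm|->] := ltngtP j mu.
- have im : (mu - j.+1 < mu)%N by rewrite ltn_subrL (leq_ltn_trans _ jm).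
  have {1}-> : j = (mu - (Ordinal im).+1)%N by rewrite /= subnSK// subKn// ltnW.
  rewrite coef_poly_of mxE mulrA ee mul1r /=.
  by rewrite subnSK// subKn// ltnW.
- by rewrite !nth_default ?sp ?size_poly_of.
- have := monicP (monic_poly_of e (param_of e p)).
  rewrite lead_coefE size_poly_of /= => ->.
  by have := monicP pm; rewrite lead_coefE sp.
Qed.

Lemma horner_poly_of e l x :
  (poly_of e l).[x] = x ^+ mu + \sum_(i < mu) e * l ord0 i * x ^+ (mu - i.+1).
Proof.
rewrite hornerD hornerXn horner_sum; congr (_ + _).
by apply: eq_bigr => i _; rewrite hornerZ hornerXn.
Qed.

End PolyOfParam.

(** * Non-singular parameters *)

Section Nonsingular.
Variable R : realType.

Definition simple_roots (p : {poly R}) :=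
  forall x, root p x -> p^`().[x] != 0.

Lemma is_diff_horner (p : {poly R}) (x : R) :
  is_diff x (horner p) (fun h => h * p^`().[x]).
Proof.
apply: DiffDef; first exact/derivable1_diffP/derivable_horner.
by rewrite deriv1E ?derivE//; exact: derivable_horner.
Qed.

Lemma is_diff_fst (p : R * R) : is_diff p (fst : R * R -> R) fst.
Proof.
have cf : continuous (fst : R * R -> R) by move=> x; exact: cvg_fst.
apply: DiffDef.
  by apply: (@linear_differentiable _ _ _ (fst : {linear (R * R)%type -> R})).
by rewrite (@diff_lin _ _ _ (fst : {linear (R * R)%type -> R})).
Qed.

Lemma is_diff_snd (p : R * R) : is_diff p (snd : R * R -> R) snd.
Proof.
have cf : continuous (snd : R * R -> R) by move=> x; exact: cvg_snd.
apply: DiffDef.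
  by apply: (@linear_differentiable _ _ _ (snd : {linear (R * R)%type -> R})).
by rewrite (@diff_lin _ _ _ (snd : {linear (R * R)%type -> R})).
Qed.

Lemma diff_B_family mu s (l : 'rV[R]_mu) (p v : R * R) :
  'd (B_family s l) p v =
  v.1 * (poly_of 1 l)^`().[p.1] + 2 * (-1) ^+ s * p.2 * v.2.
Proof.
have -> : B_family s l = (horner (poly_of 1 l) \o fst) +
   (horner ((-1) ^+ s *: 'X^2) \o snd).
  apply/funext => q; rewrite /B_family /= !fctE /= horner_poly_of.
  rewrite hornerZ hornerXn addrAC; congr (_ + _ + _).
  by apply: eq_bigr => i _; rewrite mul1r.
have h1 := is_diff_fst p; have h2 := is_diff_snd p.
have h3 := is_diff_horner (poly_of 1 l) p.1.
have h4 := is_diff_horner ((-1) ^+ s *: 'X^2) p.2.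
rewrite diff_val /= !fctE /= derivZ derivXn hornerZ hornerMn hornerXn /=.
by rewrite expr1 mulr2n; ring.
Qed.

Lemma C_familyE mu s (l : 'rV[R]_mu) (p : R * R) :
  C_family s l p = p.1 * p.2 +
    (-1) ^+ s * (poly_of ((-1) ^+ s) l).[p.2].
Proof.
rewrite /C_family horner_poly_of mulrDr addrA; congr (_ + _).
rewrite mulr_sumr; apply: eq_bigr => i _.
by rewrite !mulrA -expr2 sqrr_sign mul1r.
Qed.

Lemma diff_C_family mu s (l : 'rV[R]_mu) (p v : R * R) :
  'd (C_family s l) p v =
  p.2 * v.1 + (p.1 + (-1) ^+ s * (poly_of ((-1) ^+ s) l)^`().[p.2]) * v.2.
Proof.
have -> : C_family s l = (fst : R * R -> R) * (snd : R * R -> R) +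
   (horner ((-1) ^+ s *: poly_of ((-1) ^+ s) l) \o snd).
  by apply/funext => q; rewrite C_familyE !fctE /= hornerZ.
have h1 := is_diff_fst p; have h2 := is_diff_snd p.
have h4 := is_diff_horner ((-1) ^+ s *: poly_of ((-1) ^+ s) l) p.2.
rewrite diff_val /= !fctE /= derivZ hornerZ.
rewrite /GRing.scale /=; ring.
Qed.

Definition simple_nonzero_roots (p : {poly R}) :=
  simple_roots p /\ ~~ root p 0.

(** The differential is (p'(x), +- 2y). At a zero with y <> 0 its second entry
    is nonzero, so the level set is regular and transversal to the boundary; at
    a zero with y = 0, that is, at a root x of p, regularity says p'(x) <> 0,
    and the level set is then vertical, so that x = 0 is excluded. *)
Lemma nonsingular_B mu s (l : 'rV[R]_mu) :
  nonsingular (B_family s) l <-> simple_nonzero_roots (poly_of 1 l).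
Proof.
set P := poly_of 1 l.
have BE x y : B_family s l (x, y) = P.[x] + (-1) ^+ s * y ^+ 2.
  rewrite /B_family /P horner_poly_of /= addrAC; congr (_ + _ + _).
  by apply: eq_bigr => i _; rewrite mul1r.
have e0 : (-1) ^+ s != 0 :> R by rewrite signr_eq0.
split=> [[reg tra]|[simple P0]].
  have simple : simple_roots P.
    move=> x /rootP Px; have /reg : B_family s l (x, 0) = 0.
      by rewrite BE Px add0r expr0n mulr0.
    move=> /(_ 1)[v]; rewrite diff_B_family /= mulr0 mul0r addr0 => h.
    apply/eqP => h0; move: h; rewrite h0 mulr0 => /eqP.
    by rewrite eq_sym oner_eq0.
  split=> //; apply/negP => P0; have := simple _ P0.
  have /tra /(_ erefl (1, 0)) : B_family s l (0, 0) = 0.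
    by rewrite BE (rootP P0) add0r expr0n mulr0.
  move=> [u [v [+ v0 uv]]]; rewrite diff_B_family /= mulr0 mul0r addr0.
  have -> : u.1 = 1 by have /= := congr1 fst uv; rewrite v0 addr0 => <-.
  by rewrite mul1r => ->; rewrite eqxx.
split.
  move=> [x y]; rewrite BE => Bxy c.
  have [y0|y0] := eqVneq y 0.
    move: Bxy; rewrite y0 expr0n mulr0 addr0 => /rootP /simple h.
    exists (c / P^`().[x], 0); rewrite diff_B_family /= mulr0 addr0.
    by rewrite divfK.
  exists (0, c / (2 * (-1) ^+ s * y)); rewrite diff_B_family /= mul0r add0r.
  by rewrite mulrCA divff ?mulr1// !mulf_neq0// pnatr_eq0.
move=> [x y]; rewrite BE /= => Bxy x0 w; subst x.
have y0 : y != 0.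
  apply/eqP => y0; move: Bxy; rewrite y0 expr0n mulr0 addr0 => /rootP h.
  by rewrite h in P0.
exists (w.1, - (w.1 * P^`().[0]) / (2 * (-1) ^+ s * y)).
exists (0, w.2 + (w.1 * P^`().[0]) / (2 * (-1) ^+ s * y)).
split=> //; last first.
  case: w => a b; congr (_, _) => /=; rewrite ?addr0//.
  by rewrite mulNr addrCA addNr addr0.
rewrite diff_B_family /= mulrCA divff ?mulr1 ?subrr//.
by rewrite !mulf_neq0// pnatr_eq0.
Qed.

(** The differential is (y, x + e p'(y)). If p(0) = 0 then it vanishes at the
    zero (- e p'(0), 0); otherwise every zero has y <> 0 and is regular. On the
    boundary x = 0 the zeros are the roots y of p, and the level set is vertical
    there exactly when p'(y) = 0. *)
Lemma nonsingular_C mu s (l : 'rV[R]_mu) :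
  nonsingular (C_family s) l <-> simple_nonzero_roots (poly_of ((-1) ^+ s) l).
Proof.
set P := poly_of _ l; set e : R := (-1) ^+ s.
have CE x y : C_family s l (x, y) = x * y + e * P.[y] by rewrite C_familyE.
have dE x y v : 'd (C_family s l) (x, y) v =
    y * v.1 + (x + e * P^`().[y]) * v.2 by rewrite diff_C_family.
have e0 : e != 0 :> R by rewrite signr_eq0.
split=> [[reg tra]|[simple P0]].
  have P0 : ~~ root P 0.
    apply/negP => /rootP P0.
    have /reg /(_ 1)[v] : C_family s l (- (e * P^`().[0]), 0) = 0.
      by rewrite CE P0 !mulr0 addr0.
    rewrite dE mul0r addNr mul0r addr0 => /eqP.
    by rewrite eq_sym oner_eq0.
  split=> // y Py; have /tra /(_ erefl (1, 0)) : C_family s l (0, y) = 0.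
    by rewrite CE (rootP Py) mul0r mulr0 addr0.
  move=> [u [v [+ v0 uv]]]; rewrite dE.
  have -> : u.1 = 1 by have /= := congr1 fst uv; rewrite v0 addr0 => <-.
  move=> h; apply/eqP => P'y; move: h.
  rewrite P'y mulr0 addr0 mul0r addr0 mulr1.
  by move=> y0; rewrite -y0 Py in P0.
split.
  move=> [x y]; rewrite CE => Cxy c.
  have y0 : y != 0.
    apply: contraNneq P0 => y0; move: Cxy; rewrite y0 mulr0 add0r => /eqP.
    by rewrite mulf_eq0 (negbTE e0).
  by exists (c / y, 0); rewrite dE /= mulr0 addr0 mulrC divfK.
move=> [x y]; rewrite CE /= => Cxy x0 w; subst x.
have Py : root P y.
  by move/eqP: Cxy; rewrite mul0r add0r mulf_eq0 (negbTE e0).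
have P'y := simple _ Py.
exists (w.1, - (w.1 * y) / (e * P^`().[y])).
exists (0, w.2 + (w.1 * y) / (e * P^`().[y])).
split=> //; last first.
  case: w => a b; congr (_, _) => /=; rewrite ?addr0//.
  by rewrite mulNr addrCA addNr addr0.
rewrite dE /= add0r mulrCA divff ?mulf_neq0//; ring.
Qed.

End Nonsingular.

(** * Coefficientwise convergence of polynomials *)

Section CoefConvergence.
Variables (R : realType) (T : Type) (F : set_system T).
Context {FF : Filter F}.
Implicit Types (P Q : T -> {poly R}) (p q : {poly R}) (c : T -> R).

Definition coef_cvg P p := forall n, (P x)`_n @[x --> F] --> p`_n.

Lemma coef_cvg_near P Q p : (\forall x \near F, P x = Q x) ->
  coef_cvg P p -> coef_cvg Q p.
Proof.
move=> PQ cP n; apply: cvg_trans (cP n); apply: near_eq_cvg.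
by near=> x; rewrite (near PQ x).
Unshelve. all: by end_near. Qed.

Lemma coef_cvg_cst p : coef_cvg (fun=> p) p.
Proof. by move=> n; exact: cvg_cst. Qed.

Lemma coef_cvgD P Q p q : coef_cvg P p -> coef_cvg Q q ->
  coef_cvg (fun x => P x + Q x) (p + q).
Proof.
move=> cP cQ n; rewrite coefD; under eq_fun do rewrite coefD.
exact: cvgD.
Qed.

Lemma coef_cvgZ c (a : R) P p : c x @[x --> F] --> a -> coef_cvg P p ->
  coef_cvg (fun x => c x *: P x) (a *: p).
Proof.
move=> ca cP n; rewrite coefZ; under eq_fun do rewrite coefZ.
exact: cvgM.
Qed.

Lemma coef_cvgM P Q p q : coef_cvg P p -> coef_cvg Q q ->
  coef_cvg (fun x => P x * Q x) (p * q).
Proof.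
move=> cP cQ n; rewrite coefM; under eq_fun do rewrite coefM.
by apply: cvg_big => [|i _]; [exact: add_continuous|exact: cvgM].
Qed.

Lemma coef_cvg_XsubC c (a : R) : c x @[x --> F] --> a ->
  coef_cvg (fun x => 'X - (c x)%:P) ('X - a%:P).
Proof.
move=> ca n; rewrite coefB coefX coefC.
under eq_fun do rewrite coefB coefX coefC.
by apply: cvgB; [exact: cvg_cst|case: eqP => _ //; exact: cvg_cst].
Qed.

Lemma coef_cvg_prod n (P : 'I_n -> T -> {poly R}) (p : 'I_n -> {poly R}) :
  (forall i, coef_cvg (P i) (p i)) ->
  coef_cvg (fun x => \prod_(i < n) P i x) (\prod_(i < n) p i).
Proof.
elim: n P p => [|n IH] P p cP.
  under eq_fun do rewrite big_ord0.
  by rewrite big_ord0; exact: coef_cvg_cst.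
under eq_fun do rewrite big_ord_recr.
by rewrite big_ord_recr; apply: coef_cvgM => //; apply: IH.
Qed.

(** The degree bound is essential: evaluation is not continuous for
    coefficientwise convergence of polynomials of unbounded degree. *)
Lemma coef_cvg_horner n P p c (a : R) :
  (\forall x \near F, size (P x) <= n)%N -> (size p <= n)%N ->
  coef_cvg P p -> c x @[x --> F] --> a ->
  (P x).[c x] @[x --> F] --> p.[a].
Proof.
move=> sP sp cP ca; rewrite (horner_coef_wide _ sp).
have : \sum_(i < n) (P x)`_i * c x ^+ i @[x --> F] -->
    \sum_(i < n) p`_i * a ^+ i.
  apply: cvg_big => [|i _]; first exact: add_continuous.
  apply: cvgM; first exact: cP.
  by apply: (cvg_comp _ (fun y : R => y ^+ i) ca); exact: exprn_continuous.
apply: cvg_trans; apply: near_eq_cvg; near=> x.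
by rewrite (@horner_coef_wide _ n)//; near: x.
Unshelve. all: by end_near. Qed.

(** Synthetic division: Q`_m = P`_(m+1) + c * Q`_(m+1), so the coefficients of
    the quotients converge by descending induction, starting above the degree
    where they vanish. *)
Lemma coef_cvg_divXsubC n P Q p q c (a : R) :
  (\forall x \near F, size (Q x) <= n)%N -> (size q <= n)%N ->
  (\forall x \near F, P x = ('X - (c x)%:P) * Q x) -> p = ('X - a%:P) * q ->
  coef_cvg P p -> c x @[x --> F] --> a -> coef_cvg Q q.
Proof.
move=> sQ sq PQ pq cP ca.
have coefE (r s : {poly R}) b m : r = ('X - b%:P) * s ->
    s`_m = r`_m.+1 + b * s`_m.+1.
  by move=> ->; rewrite mulrBl coefB coefXM coefCM /= subrK.
(* k bounds the distance from m to the degrees where Q x and q vanish *)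
suff H k m : (n <= m + k)%N -> (Q x)`_m @[x --> F] --> q`_m.
  by move=> m; apply: (H n); rewrite leq_addl.
elim: k m => [|k IH] m nm.
  apply: cvg_near_cst; near=> x; rewrite addn0 in nm.
  rewrite !nth_default ?(leq_trans sq)//.
  by apply: (leq_trans _ nm); near: x.
rewrite (coefE _ _ _ _ pq).
have : (P x)`_m.+1 + c x * (Q x)`_m.+1 @[x --> F] --> p`_m.+1 + a * q`_m.+1.
  apply: cvgD; first exact: cP.
  by apply: cvgM => //; apply: IH; rewrite addSnnS.
apply: cvg_trans; apply: near_eq_cvg; near=> x.
by rewrite -(coefE (P x))//; near: x.
Unshelve. all: by end_near. Qed.

End CoefConvergence.

(** * Persistence of real roots and of their absence *)

Section RootPersistence.
Variables (R : realType).
Implicit Types (p q : {poly R}) (c : R).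

Definition monic_of n p := (p \is monic) && (size p == n.+1).

Lemma monic_of_neq0 n p : monic_of n p -> p != 0.
Proof. by move=> /andP[/monic_neq0]. Qed.

Definition rootless p := forall x, ~~ root p x.

(** The default value c is only returned when p has no real root. *)
Definition nearest_root c p :=
  head c (sort (fun x y => `|x - c| <= `|y - c|) (rootsR p)).

Lemma mem_rootsR p x : p != 0 -> (x \in rootsR p) = root p x.
Proof. by move=> p0; rewrite -roots_on_rootsR// in_itv. Qed.

Lemma nearest_rootP c p y : p != 0 -> root p y ->
  root p (nearest_root c p) /\ `|nearest_root c p - c| <= `|y - c|.
Proof.
move=> p0 py; rewrite /nearest_root.
set leT := (fun x y => _ <= _).
have tot : total leT by move=> u v; exact: le_total.
have tr : transitive leT by move=> u v w; exact: le_trans.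
have := mem_sort leT (rootsR p); have := sort_sorted tot (rootsR p).
case: (sort _ _) => [|z s] /= zs ms.
  by have := ms y; rewrite mem_rootsR// py.
have [zp] : root p z by rewrite -mem_rootsR// -ms mem_head.
split=> //; have := ms y; rewrite mem_rootsR// py inE => /predU1P[->//|ys].
by have /allP/(_ _ ys) := order_path_min tr zs.
Qed.

(** As q has a constant sign near c, p changes sign between c - h and c + h for
    every small h; so do the nearby polynomials, which therefore have a root in
    between. *)
Lemma cvg_nearest_root T (F : set_system T) {FF : Filter F} n
    (P : T -> {poly R}) p q c :
  (\forall x \near F, monic_of n (P x)) -> monic_of n p ->
  coef_cvg F P p -> p = ('X - c%:P) * q -> ~~ root q c ->
  (nearest_root c (P x) @[x --> F] --> c) /\
  (\forall x \near F, root (P x) (nearest_root c (P x))).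
Proof.
move=> mP mp cP pq qc.
have key e : 0 < e -> \forall x \near F, exists2 y, `|y - c| < e & root (P x) y.
  move=> e0.
  have [d d0 dq] : exists2 d, 0 < d &
      forall z, `|z - c| < d -> 0 < q.[c] * q.[z].
    have q2 : 0 < q.[c] * q.[c].
      by rewrite -expr2 exprn_even_gt0.
    have : q.[c] * q.[z] @[z --> c] --> q.[c] * q.[c].
      by apply: cvgM; [exact: cvg_cst|exact: continuous_horner].
    move=> /cvgr_gt /(_ _ q2) /nbhs_ballP[d /= d0 dq]; exists d => // z zc.
    by apply: dq; rewrite /ball /= distrC.
  pose h := Num.min e d / 2.
  have h0 : 0 < h by rewrite divr_gt0// lt_min e0.
  have hed : h < e /\ h < d.
    have : h < Num.min e d by rewrite ltr_pdivrMr// ltr_pMr ?lt_min ?e0// ltr1n.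
    by rewrite lt_min => /andP.
  have [he hd] := hed.
  have sP : \forall x \near F, (size (P x) <= n.+1)%N.
    by apply: filterS mP => x /andP[_ /eqP->].
  have sp : (size p <= n.+1)%N by have /andP[_ /eqP->] := mp.
  have neg : p.[c - h] * p.[c + h] < 0.
    have h1 : 0 < q.[c] * q.[c - h].
      by apply: dq; rewrite addrAC subrr sub0r normrN gtr0_norm.
    have h2 : 0 < q.[c] * q.[c + h].
      by apply: dq; rewrite addrAC subrr add0r gtr0_norm.
    have h3 : 0 < q.[c - h] * q.[c + h].
      have := mulr_gt0 h1 h2; rewrite mulrACA -expr2 pmulr_rgt0//.
      by rewrite exprn_even_gt0.
    rewrite pq !hornerM !hornerXsubC.
    have -> : (c - h - c) * q.[c - h] * ((c + h - c) * q.[c + h]) =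
      - (h ^+ 2 * (q.[c - h] * q.[c + h])) by ring.
    by rewrite oppr_lt0 mulr_gt0// exprn_gt0.
  have cvg1 : (P x).[c - h] * (P x).[c + h] @[x --> F] -->
      p.[c - h] * p.[c + h].
    apply: cvgM.
    - apply: (@coef_cvg_horner _ _ _ _ n.+1 P p (fun=> c - h)) => //.
      exact: cvg_cst.
    - apply: (@coef_cvg_horner _ _ _ _ n.+1 P p (fun=> c + h)) => //.
      exact: cvg_cst.
  apply: filterS (cvgr_lt _ cvg1 0 neg) => x Px.
  have le : c - h <= c + h by lra.
  have [y] := poly_ivtoo le Px; rewrite in_itv /= => /andP[y1 y2] ry.
  exists y => //; rewrite (lt_trans _ he)// ltr_norml ltrBlDl ltrBrDl.
  by rewrite y1 y2.
split.
  apply/cvgrPdist_lt => e e0; have := key e e0; move: mP; apply: filterS2.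
  move=> x mx [y ye yr].
  have [_ h] := nearest_rootP c (monic_of_neq0 mx) yr.
  by rewrite distrC (le_lt_trans h).
have := key 1 ltr01; move: mP; apply: filterS2 => x mx [y _ yr].
by have [] := nearest_rootP c (monic_of_neq0 mx) yr.
Qed.

(** The roots of nearby polynomials stay in a fixed segment, by the Cauchy
    bound. On the segment, evaluation is jointly continuous in the polynomial
    and the point, so non-vanishing at the limit spreads to a neighbourhood
    uniformly by compactness. *)
Lemma near_rootless T (F : set_system T) {FF : Filter F} n
    (P : T -> {poly R}) p :
  (\forall x \near F, monic_of n (P x)) -> monic_of n p ->
  coef_cvg F P p -> rootless p -> \forall x \near F, rootless (P x).
Proof.
move=> mP mp cP rp.
have sP : \forall x \near F, (size (P x) <= n.+1)%N.
  by apply: filterS mP => x /andP[_ /eqP->].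
have sp : (size p <= n.+1)%N by have /andP[_ /eqP->] := mp.
have cbE r : monic_of n r -> cauchy_bound r = 1 + \sum_(i < n.+1) `|r`_i|.
  rewrite /cauchy_bound => /andP[/monicP -> /eqP ->].
  by rewrite normr1 invr1 mul1r.
pose M := cauchy_bound p + 1.
have bnd : \forall x \near F, cauchy_bound (P x) < M.
  have : 1 + \sum_(i < n.+1) `|(P x)`_i| @[x --> F] -->
      1 + \sum_(i < n.+1) `|p`_i|.
    apply: cvgD; first exact: cvg_cst.
    apply: cvg_big => [|i _]; first exact: add_continuous.
    by apply: cvg_norm; exact: cP.
  rewrite -cbE// => /cvgr_lt /(_ M); rewrite ltrDl ltr01 => /(_ isT).
  by move: mP; apply: filterS2 => x mx; rewrite -cbE.
have cov : \forall x \near F, `[- M, M]%classic `<=` [set z | ~~ root (P x) z].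
  have /compact_near_coveringP := @segment_compact R (- M) M.
  apply => z _.
  have cj : (P y.2).[y.1] @[y --> (nbhs z, F)] --> p.[z].
    apply: (@coef_cvg_horner _ _ _ _ n.+1 (P \o snd) p fst) => //.
    - exact: (cvg_snd sP).
    - by move=> m; apply: (cvg_comp snd _ _ (cP m)); exact: cvg_snd.
    - exact: cvg_fst.
  have : \forall y \near (nbhs z, F), (P y.2).[y.1] != 0.
    by apply: (cvgr_neq0 _ cj); exact: rp.
  by apply: filterS => y /=.
near=> x => z; apply/negP => xz.
have xM : `|z| < M.
  rewrite (lt_trans (cauchy_boundP _ (rootP xz)))//; last by near: x.
  by apply: (@monic_of_neq0 n); near: x.
have /(_ z) : `[- M, M]%classic `<=` [set z | ~~ root (P x) z] by near: x.
rewrite /= in_itv /= xz -ler_norml (ltW xM) => /(_ isT).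
by [].
Unshelve. all: by end_near. Qed.
End RootPersistence.

(** * Monic polynomials without real roots *)

Section Monic.
Variable R : realType.
Implicit Types (p q : {poly R}) (s : seq R).

Lemma monic_ofE n p : monic_of n p = (size p <= n.+1)%N && (p`_n == 1).
Proof.
apply/andP/andP => [[/monicP pm /eqP sp]|[sp /eqP pn]].
  by rewrite sp leqnn -pm lead_coefE sp.
have s : size p = n.+1.
  apply/eqP; rewrite eqn_leq sp ltnNge; apply/negP => h.
  by move: pn; rewrite nth_default// => /eqP; rewrite eq_sym oner_eq0.
by rewrite monicE lead_coefE s pn eqxx.
Qed.

Lemma monic_ofM m n p q :
  monic_of m p -> monic_of (m + n) (p * q) = monic_of n q.
Proof.
move=> /andP[pm /eqP sp]; rewrite /monic_of monicMl//.
have [->|q0] := eqVneq q 0.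
  rewrite (_ : ((0 : {poly R}) \is monic) = false)//.
  by apply/negbTE/negP => /monic_neq0/eqP.
by rewrite size_monicM// sp addSn /= -addnS eqn_add2l.
Qed.

Lemma monic_of_prod s : monic_of (size s) (\prod_(c <- s) ('X - c%:P)).
Proof. by rewrite /monic_of monic_prod_XsubC size_prod_XsubC eqxx. Qed.

Lemma monic_of_conv n p q (t : R) : monic_of n p -> monic_of n q ->
  monic_of n ((1 - t) *: p + t *: q).
Proof.
rewrite !monic_ofE => /andP[sp /eqP pn] /andP[sq /eqP qn].
rewrite coefD !coefZ pn qn !mulr1 subrK eqxx andbT.
rewrite (leq_trans (size_polyD _ _))// geq_max.
by rewrite !(leq_trans (size_scale_leq _ _)).
Qed.

Lemma rootless_gt0 p : p \is monic -> rootless p -> forall x, 0 < p.[x].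
Proof.
move=> pm rp x; have := @sgp_pinftyP _ x p (fun y _ => rp y) x.
rewrite in_itv /= lexx => /(_ isT).
by rewrite /sgp_pinfty (monicP pm) sgr1 => /eqP; rewrite sgr_cp0.
Qed.

Lemma convex_gt0 (t a b : R) : 0 <= t <= 1 -> 0 < a -> 0 < b ->
  0 < (1 - t) * a + t * b.
Proof.
move=> /andP[t0 t1] a0 b0; have [->|tn0] := eqVneq t 0; first lra.
have h1 : 0 <= (1 - t) * a by rewrite mulr_ge0 ?subr_ge0// ltW.
have h2 : 0 < t * b by rewrite mulr_gt0// lt_neqAle eq_sym tn0.
lra.
Qed.

End Monic.

(** * Continuity of the factorization *)

Section RootLists.
Variable R : realType.
Implicit Types (p q : {poly R}) (s : seq R).

Notation lin s := (\prod_(c <- s) ('X - c%:P)).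

(** Induction on the list s, one nearby root being split off for each entry.
    That no real root is left in the last cofactor ensures that Y x lists all
    the real roots of P x. *)
Lemma cvg_root_factor s T (F : set_system T) {FF : Filter F} n
    (P : T -> {poly R}) q :
  uniq s -> rootless q -> (\forall x \near F, monic_of n (P x)) ->
  monic_of n (lin s * q) -> coef_cvg F P (lin s * q) ->
  exists (Y : T -> seq R) (Q : T -> {poly R}),
    [/\ forall x, size (Y x) = size s, forall i, (Y x)`_i @[x --> F] --> s`_i,
      coef_cvg F Q q &
      \forall x \near F, P x = lin (Y x) * Q x /\ rootless (Q x)].
Proof.
elim: s n P => [|c s IH] n P.
  rewrite big_nil mul1r => _ rq mP mq cP; exists (fun=> [::]), P; split=> //.
    by move=> i; exact: cvg_cst.
  apply: filterS (near_rootless mP mq cP rq) => x.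
  by rewrite big_nil mul1r.
rewrite big_cons -mulrA /= => /andP[cs us] rq.
set p' := lin s * q => mP mp cP.
have p'c : ~~ root p' c.
  by rewrite rootM root_prod_XsubC negb_or cs rq.
have [m nm] : exists m, n = m.+1.
  case: n mp {mP} => [|m _]; last by exists m.
  move=> /andP[pm /eqP sp].
  have /size_poly1P[a a0 pa] : size (('X - c%:P) * p') == 1%N by rewrite sp.
  have : root (('X - c%:P) * p') c by rewrite rootM root_XsubC eqxx.
  by rewrite pa rootC (negbTE a0).
subst n; have monicX (d : R) : monic_of 1 ('X - d%:P).
  by rewrite /monic_of monicXsubC size_XsubC.
have [ynear yroot] := cvg_nearest_root mP mp cP erefl p'c.
set y := (fun x => nearest_root c (P x)) in ynear yroot.
pose P1 x := P x %/ ('X - (y x)%:P).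
have PP1 : \forall x \near F, P x = ('X - (y x)%:P) * P1 x.
  apply: filterS yroot => x yx; rewrite mulrC divpK//.
  by rewrite dvdp_XsubCl.
have mp' : monic_of m p' by rewrite -(monic_ofM _ _ (monicX c)).
have mP1 : \forall x \near F, monic_of m (P1 x).
  move: PP1 mP; apply: filterS2 => x xP1.
  by rewrite {1}xP1 -[m.+1]add1n monic_ofM.
have cP1 : coef_cvg F P1 p'.
  apply: (@coef_cvg_divXsubC _ _ _ _ m.+1 P P1 _ p' y c) => //.
    by apply: filterS mP1 => x /andP[_ /eqP->].
  by have /andP[_ /eqP->] := mp'.
have [Y [Q [sY cY cQ PQ]]] := IH m P1 us rq mP1 mp' cP1.
exists (fun x => y x :: Y x), Q; split=> //.
- by move=> x /=; rewrite sY.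
- by case.
- move: PP1 PQ; apply: filterS2 => x -> [-> ?]; split=> //.
  by rewrite big_cons mulrA.
Qed.

Lemma rootsR_lin s q : sorted <%R s -> q != 0 -> rootless q ->
  rootsR (lin s * q) = s.
Proof.
move=> ss q0 rq; apply: (irr_sorted_eq lt_trans ltxx) => //.
  exact: sorted_roots.
have l0 : lin s != 0 by exact/monic_neq0/monic_prod_XsubC.
move=> x; rewrite mem_rootsR ?mulf_neq0// rootM root_prod_XsubC.
by rewrite (negbTE (rq x)) orbF.
Qed.

(** The cofactor of the product of the distinct linear factors of p; it has no
    real root when the real roots of p are simple. *)
Definition rootfree p := p %/ lin (rootsR p).

Lemma rootfree_lin s q : sorted <%R s -> q != 0 -> rootless q ->
  rootfree (lin s * q) = q.
Proof.
move=> ss q0 rq; rewrite /rootfree rootsR_lin// mulKp//.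
exact/monic_neq0/monic_prod_XsubC.
Qed.

Lemma rootsR_uniq p : uniq (rootsR p).
Proof. exact/lt_sorted_uniq/sorted_roots. Qed.

Lemma leq_size_rootsR n p : monic_of n p -> (size (rootsR p) <= n)%N.
Proof.
move=> mp; have p0 := monic_of_neq0 mp; rewrite -ltnS.
have /andP[_ /eqP <-] := mp.
apply: max_poly_roots => //; last exact: rootsR_uniq.
by apply/allP => x; rewrite mem_rootsR.
Qed.

Lemma rootfreeE p : p != 0 -> p = lin (rootsR p) * rootfree p.
Proof.
move=> p0; have [q pq] : exists q, p = q * lin (rootsR p).
  apply: uniq_roots_prod_XsubC; last by rewrite uniq_rootsE rootsR_uniq.
  by apply/allP => x; rewrite mem_rootsR.
rewrite /rootfree {3}pq mulpK; last exact/monic_neq0/monic_prod_XsubC.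
by rewrite mulrC.
Qed.

Lemma rootless_rootfree p : p != 0 -> simple_roots p -> rootless (rootfree p).
Proof.
move=> p0 sp x; apply/negP => xq.
have px : root p x by rewrite (rootfreeE p0) rootM xq orbT.
have xs : x \in rootsR p by rewrite mem_rootsR.
have /negP := sp _ px; apply; rewrite (rootfreeE p0) (big_rem x)//=.
have /factor_theorem[r ->] := xq.
by rewrite !derivM !derivXsubC !hornerE /= subrr !(mulr0, mul0r, addr0).
Qed.

Lemma simple_roots_lin s q : uniq s -> rootless q -> simple_roots (lin s * q).
Proof.
move=> us rq x; rewrite rootM (negbTE (rq x)) orbF root_prod_XsubC => xs.
rewrite (big_rem x)//= -mulrA derivM derivXsubC !hornerE /= subrr mul0r addr0.
rewrite -hornerM -[_ == _]/(root _ x) rootM (negbTE (rq x)) orbF.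
by rewrite root_prod_XsubC mem_rem_uniqF.
Qed.

(** The invariant that labels the strata: for nonzero roots, it records the
    numbers of negative and of positive ones. *)
Definition root_signs p := [seq 0 < x | x <- rootsR p].

(** Strict inequalities between limits are inherited by nearby terms, so the
    lists given by [cvg_root_factor] are eventually sorted, hence equal to the
    sorted lists of roots, and eventually have the signs of the limit list. *)
Lemma cvg_real_roots T (F : set_system T) {FF : Filter F} n
    (P : T -> {poly R}) p :
  (\forall x \near F, monic_of n (P x)) -> monic_of n p -> coef_cvg F P p ->
  simple_nonzero_roots p ->
  [/\ \forall x \near F, root_signs (P x) = root_signs p,
    forall i, (rootsR (P x))`_i @[x --> F] --> (rootsR p)`_i &
    coef_cvg F (fun x => rootfree (P x)) (rootfree p)].
Proof.
move=> mP mp cP [simple p00]; have p0 := monic_of_neq0 mp.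
set s := rootsR p; set q := rootfree p.
have pE : p = lin s * q by exact: rootfreeE.
have ss : sorted <%R s by exact: sorted_roots.
have rq : rootless q by exact: rootless_rootfree.
have s0 x : x \in s -> x != 0.
  by rewrite mem_rootsR// => px; apply: contraNneq p00 => <-.
rewrite pE in mp cP.
have [Y [Q [sY cY cQ PQ]]] := cvg_root_factor (rootsR_uniq p) rq mP mp cP.
have sortY : \forall x \near F, sorted <%R (Y x).
  have HY : \forall x \near F, forall i : 'I_(size s),
      (i.+1 < size s)%N -> (Y x)`_i < (Y x)`_i.+1.
    apply: filter_forall => i.
    have [ilt|_] := ltnP i.+1 (size s); last exact: nearW.
    have : (Y x)`_i.+1 - (Y x)`_i @[x --> F] --> s`_i.+1 - s`_i.
      by apply: cvgB; exact: cY.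
    move=> /cvgr_gt/(_ 0); rewrite subr_gt0 => H.
    apply: filterS (H (elimT (sortedP 0) ss i ilt)) => x.
    by rewrite subr_gt0.
  apply: filterS HY => x Hx; apply/(sortedP 0) => i; rewrite sY => ilt.
  exact: (Hx (Ordinal (ltnW ilt))).
have PY : \forall x \near F, rootsR (P x) = Y x /\ rootfree (P x) = Q x.
  near=> x.
  have [PE rQ] : P x = lin (Y x) * Q x /\ rootless (Q x) by near: x.
  have Q0 : Q x != 0.
    have : monic_of n (P x) by near: x.
    move/monic_of_neq0; apply: contraNneq => Qx0; by rewrite PE Qx0 mulr0.
  have sYx : sorted <%R (Y x) by near: x.
  by rewrite PE rootsR_lin// rootfree_lin.
split.
- have sgY : \forall x \near F, forall i : 'I_(size s),
      (0 < (Y x)`_i) = (0 < s`_i).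
    apply: filter_forall => i.
    have : s`_i != 0 by apply: s0; rewrite mem_nth.
    rewrite neq_lt => /orP[] si.
      apply: filterS (cvgr_lt _ (cY i) _ si) => x Yx.
      by rewrite !ltNge (ltW Yx) (ltW si).
    by apply: filterS (cvgr_gt _ (cY i) _ si) => x Yx; rewrite Yx si.
  apply: filterS2 PY sgY => x [PY _] sg; rewrite /root_signs PY.
  apply: (@eq_from_nth _ false); first by rewrite !size_map sY.
  move=> i; rewrite size_map sY => ilt.
  by rewrite !(nth_map 0) ?sY// (sg (Ordinal ilt)).
- move=> i; apply: cvg_trans (cY i); apply: near_eq_cvg.
  by apply: filterS PY => x [-> _].
- by apply: coef_cvg_near cQ; apply: filterS PY => x [].
Unshelve. all: by end_near. Qed.

(** * The contraction of a stratum *)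

Definition convex_seq t s s0 :=
  mkseq (fun i => (1 - t) * s`_i + t * s0`_i) (size s).

Definition deform p0 (t : R) p :=
  lin (convex_seq t (rootsR p) (rootsR p0)) *
    ((1 - t) *: rootfree p + t *: rootfree p0).

(** The product over ordinals has a number of factors that is locally constant
    in p, which is the form suited to continuity. *)
Lemma deformE p0 t p : deform p0 t p =
  \prod_(i < size (rootsR p))
    ('X - ((1 - t) * (rootsR p)`_i + t * (rootsR p0)`_i)%:P) *
  ((1 - t) *: rootfree p + t *: rootfree p0).
Proof.
rewrite /deform /convex_seq big_map; congr (_ * _).
rewrite -(big_mkord xpredT (fun i => 'X -
  ((1 - t) * (rootsR p)`_i + t * (rootsR p0)`_i)%:P)).
by rewrite /index_iota subn0.
Qed.

Lemma deform0 p0 p : p != 0 -> deform p0 0 p = p.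
Proof.
move=> pn0; rewrite /deform subr0 scale1r scale0r addr0.
rewrite (_ : convex_seq _ _ _ = rootsR p) -?rootfreeE//.
rewrite -[RHS](mkseq_nth 0); apply: eq_mkseq => i.
by rewrite subr0 mul1r mul0r addr0.
Qed.

Lemma deform1 p0 p : p0 != 0 -> root_signs p = root_signs p0 ->
  deform p0 1 p = p0.
Proof.
move=> p00 /(congr1 size); rewrite !size_map => sz.
rewrite /deform subrr scale1r scale0r add0r.
rewrite (_ : convex_seq _ _ _ = rootsR p0) -?rootfreeE//.
rewrite -[RHS](mkseq_nth 0) -sz; apply: eq_mkseq => i.
by rewrite subrr mul1r mul0r add0r.
Qed.

(** All the conditions are convex in (roots, cofactor): the order and the signs
    of the roots, and for the cofactor being monic of a given degree and
    positive everywhere. *)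
Lemma deform_stratum n p0 t p : 0 <= t <= 1 ->
  monic_of n p0 -> monic_of n p ->
  simple_nonzero_roots p0 -> simple_nonzero_roots p ->
  root_signs p = root_signs p0 ->
  [/\ monic_of n (deform p0 t p), simple_nonzero_roots (deform p0 t p) &
    root_signs (deform p0 t p) = root_signs p0].
Proof.
move=> t01 mp0 mp [simp0 p00] [simp pn0] sg.
have nz0 := monic_of_neq0 mp0; have nz := monic_of_neq0 mp.
have sz : size (rootsR p) = size (rootsR p0).
  by have := congr1 size sg; rewrite !size_map.
have sgi i : (i < size (rootsR p))%N ->
    (0 < (rootsR p)`_i) = (0 < (rootsR p0)`_i).
  move=> ip; have := congr1 (fun b => nth false b i) sg.
  by rewrite !(nth_map 0)// -sz.
have rn0 (r : {poly R}) i : simple_nonzero_roots r -> r != 0 ->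
    (i < size (rootsR r))%N -> (rootsR r)`_i != 0.
  move=> [_ r0] rn ir; apply: contraNneq r0 => <-.
  by rewrite -mem_rootsR// mem_nth.
set s := convex_seq t (rootsR p) (rootsR p0).
set q := (1 - t) *: rootfree p + t *: rootfree p0.
have ss : size s = size (rootsR p) by rewrite size_mkseq.
have mrf r : monic_of n r -> size (rootsR r) = size s ->
    monic_of (n - size s) (rootfree r).
  move=> mr sr; have r0 := monic_of_neq0 mr.
  have ml := monic_of_prod (rootsR r); rewrite sr in ml.
  rewrite -(monic_ofM _ _ ml) -rootfreeE// subnKC// -sr.
  exact: leq_size_rootsR.
have mq : monic_of (n - size s) q.
  by apply: monic_of_conv; apply: mrf; rewrite // ss.
have q0 := monic_of_neq0 mq.
have rq : rootless q.
  move=> x; rewrite /root /q hornerD !hornerZ gt_eqF// convex_gt0//.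
    apply: rootless_gt0; last exact: rootless_rootfree.
    by have /andP[] := mrf _ mp (esym ss).
  apply: rootless_gt0; last exact: rootless_rootfree.
  by have /andP[] := mrf _ mp0 (etrans (esym sz) (esym ss)).
have si i : (i < size (rootsR p))%N ->
    s`_i = (1 - t) * (rootsR p)`_i + t * (rootsR p0)`_i.
  by move=> ip; rewrite nth_mkseq.
have sgs i : (i < size (rootsR p))%N ->
    s`_i != 0 /\ (0 < s`_i) = (0 < (rootsR p0)`_i).
  move=> ip; rewrite si//; have := sgi i ip.
  have ip0 : (i < size (rootsR p0))%N by rewrite -sz.
  have := rn0 p i (conj simp pn0) nz ip.
  have := rn0 p0 i (conj simp0 p00) nz0 ip0.
  move: (rootsR p)`_i (rootsR p0)`_i => a b b0 a0.
  have [bpos|bneg|b0'] := ltgtP 0 b; last by rewrite -b0' eqxx in b0.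
    by move=> apos; have h := convex_gt0 t01 apos bpos; rewrite h gt_eqF.
  move=> /negbT; rewrite -leNgt le_eqVlt (negbTE a0) /= => aneg.
  have : 0 < (1 - t) * - a + t * - b by apply: convex_gt0; rewrite ?oppr_gt0.
  rewrite !mulrN -opprD oppr_gt0 => h.
  by rewrite lt_eqF// ltNge (ltW h).
have sorteds : sorted <%R s.
  apply/(sortedP 0) => i; rewrite ss => ip.
  rewrite !si//; last exact: ltnW.
  rewrite -subr_gt0 (_ : _ - _ = (1 - t) * ((rootsR p)`_i.+1 - (rootsR p)`_i) +
     t * ((rootsR p0)`_i.+1 - (rootsR p0)`_i)); last by ring.
  apply: convex_gt0 => //; rewrite subr_gt0.
    by apply: (elimT (sortedP 0) (sorted_roots _ _ _)).
  by apply: (elimT (sortedP 0) (sorted_roots _ _ _)); rewrite -/(rootsR _) -sz.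
rewrite /deform -/s -/q; split.
- have ml := monic_of_prod s.
  have sn : (size s <= n)%N by rewrite ss leq_size_rootsR.
  by rewrite -(subnKC sn) (monic_ofM _ _ ml).
- split; first by apply: simple_roots_lin => //; exact: lt_sorted_uniq.
  rewrite rootM negb_or rq andbT root_prod_XsubC; apply/negP => /(nthP 0)[i].
  by rewrite ss => ip /eqP; apply/negP; have [] := sgs i ip.
- rewrite /root_signs rootsR_lin//.
  have sm : size [seq 0 < x | x <- s] = size s by rewrite size_map.
  apply: (@eq_from_nth _ false); first by rewrite sm ss size_map.
  move=> i; rewrite sm ss => ip.
  have [_ h] := sgs i ip.
  rewrite (nth_map 0) ?ss// h (nth_map 0)// -sz//.
Qed.

End RootLists.

(** * Connected components *)

Section Topology.

Lemma cvg_row (R : realType) n T (F : set_system T) {FF : Filter F}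
    (L : T -> 'rV[R]_n) (l : 'rV[R]_n) :
  (forall i, L x ord0 i @[x --> F] --> l ord0 i) -> L x @[x --> F] --> l.
Proof.
move=> cL A [B nB sB].
have : \forall x \near F, forall i, B ord0 i (L x ord0 i).
  by apply: filter_forall => i; apply: cL; exact: nB.
by apply: filterS => x Bx; apply: sB => i j; rewrite ord1.
Qed.

Lemma locally_cst_connected (T : topologicalType) (U : Type) (f : T -> U)
    (A : set T) (x y : T) :
  (forall z, A z -> \forall w \near z, f w = f z) ->
  connected A -> A x -> A y -> f y = f x.
Proof.
move=> lf cA Ax Ay; pose V := [set z | f z = f x].
suff : A `&` V = A by move=> AV; have : A y by []; rewrite -AV => -[].
apply: cA; first by exists x.
  exists V°; first exact: open_interior.
  apply/seteqP; split=> z [Az Vz]; split=> //.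
    by apply: filterS (lf _ Az) => w; rewrite /V /= => ->.
  exact: interior_subset Vz.
exists (~` (~` V)°); first by apply: open_closedC; exact: open_interior.
apply/seteqP; split=> z [Az Vz]; split=> //.
  by move=> /interior_subset; exact.
apply: contrapT => nV; apply: Vz; apply: filterS (lf _ Az) => w fw.
by rewrite /V /= fw.
Qed.

Variables (R : realType) (mu : nat) (e : R).
Hypothesis ee : e * e = 1.
Implicit Types (l : 'rV[R]_mu).

Lemma monic_of_poly_of l : monic_of mu (poly_of e l).
Proof. by rewrite /monic_of monic_poly_of size_poly_of eqxx. Qed.

Lemma poly_of_param_of (p : {poly R}) :
  monic_of mu p -> poly_of e (param_of mu e p) = p.
Proof. by move=> /andP[pm /eqP sp]; exact: param_ofK. Qed.

Lemma coef_cvg_poly_of T (F : set_system T) {FF : Filter F}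
    (L : T -> 'rV[R]_mu) l :
  L x @[x --> F] --> l -> coef_cvg F (fun x => poly_of e (L x)) (poly_of e l).
Proof.
move=> cL; apply: coef_cvgD; first exact: coef_cvg_cst.
move=> n; rewrite coef_sum; under eq_fun do rewrite coef_sum.
apply: cvg_big => [|i _]; first exact: add_continuous.
rewrite coefZ; under eq_fun do rewrite coefZ.
apply: cvgM; last exact: cvg_cst.
apply: cvgM; first exact: cvg_cst.
exact: (cvg_comp _ _ cL (@coord_continuous R _ _ ord0 i l)).
Qed.

Lemma cvg_param_of T (F : set_system T) {FF : Filter F}
    (P : T -> {poly R}) p :
  coef_cvg F P p -> param_of mu e (P x) @[x --> F] --> param_of mu e p.
Proof.
move=> cP; apply: cvg_row => i; rewrite mxE; under eq_fun do rewrite mxE.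
by apply: cvgM; [exact: cvg_cst|exact: cP].
Qed.

Let regular l := simple_nonzero_roots (poly_of e l).
Let signs l := root_signs (poly_of e l).

Definition contraction l0 (x : 'rV[R]_mu * R) : 'rV[R]_mu :=
  param_of mu e (deform (poly_of e l0) x.2 (poly_of e x.1)).

Lemma near_signs l : regular l -> \forall l' \near l, signs l' = signs l.
Proof.
move=> gl.
have [] // :=
  @cvg_real_roots R _ (nbhs l) _ mu (fun l' => poly_of e l') (poly_of e l).
- by apply: nearW => l'; exact: monic_of_poly_of.
- exact: monic_of_poly_of.
- exact: (@coef_cvg_poly_of _ (nbhs l) _ id).
Qed.

Lemma contraction_continuous l0 l t : regular l ->
  {for (l, t), continuous (contraction l0)}.
Proof.
move=> gl; apply: (@cvg_param_of _ (nbhs (l, t)) _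
  (fun x => deform (poly_of e l0) x.2 (poly_of e x.1))) => /=.
have cfst : (fst : 'rV[R]_mu * R -> _) x @[x --> nbhs (l, t)] --> l.
  exact: cvg_fst.
have csnd : (snd : 'rV[R]_mu * R -> R) x @[x --> nbhs (l, t)] --> t.
  exact: cvg_snd.
have mP : \forall x \near nbhs (l, t), monic_of mu (poly_of e x.1).
  by apply: nearW => x; exact: monic_of_poly_of.
have [sg cr crf] :=
  cvg_real_roots mP (monic_of_poly_of l) (coef_cvg_poly_of cfst) gl.
have c1t : 1 - x.2 @[x --> nbhs (l, t)] --> 1 - t.
  by apply: cvgB => //; exact: cvg_cst.
pose p0 := poly_of e l0; pose p := poly_of e l.
have main : coef_cvg (nbhs (l, t)) (fun x : 'rV[R]_mu * R =>
    \prod_(i < size (rootsR p))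
      ('X - ((1 - x.2) * (rootsR (poly_of e x.1))`_i +
             x.2 * (rootsR p0)`_i)%:P) *
    ((1 - x.2) *: rootfree (poly_of e x.1) + x.2 *: rootfree p0))
   (deform p0 t p).
  rewrite deformE; apply: coef_cvgM; last first.
    by apply: coef_cvgD; apply: coef_cvgZ => //; exact: coef_cvg_cst.
  apply: coef_cvg_prod => i; apply: coef_cvg_XsubC.
  by apply: cvgD; apply: cvgM => //; exact: cvg_cst.
apply: coef_cvg_near main; apply: filterS sg => x /(congr1 size).
by rewrite !size_map deformE => ->.
Qed.

Lemma contraction_stratum l0 l t : 0 <= t <= 1 -> regular l0 -> regular l ->
  signs l = signs l0 ->
  regular (contraction l0 (l, t)) /\ signs (contraction l0 (l, t)) = signs l0.
Proof.
move=> t01 g0 gl sg; rewrite /regular /signs.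
have [m gd sd] :=
  deform_stratum t01 (monic_of_poly_of l0) (monic_of_poly_of l) g0 gl sg.
by rewrite !poly_of_param_of.
Qed.

Lemma contraction0 l0 l : contraction l0 (l, 0) = l.
Proof.
rewrite /contraction /= deform0 ?poly_ofK//.
exact: monic_of_neq0 (monic_of_poly_of _).
Qed.

Lemma contraction1 l0 l : signs l = signs l0 -> contraction l0 (l, 1) = l0.
Proof.
move=> sg; rewrite /contraction /= deform1 ?poly_ofK//.
exact: monic_of_neq0 (monic_of_poly_of _).
Qed.

(** Connected subsets lie in one stratum because the signs of the roots are
    locally constant; conversely the contraction joins any point of the stratum
    to l0 by a path. *)
Lemma componentE l0 : regular l0 ->
  connected_component [set l | regular l] l0 =
  [set l | regular l /\ signs l = signs l0].
Proof.
move=> g0; apply/seteqP; split=> l.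
  move=> [A [Al0 Areg cA] Al]; split; first exact: Areg.
  by apply: (locally_cst_connected (A := A)) => // z /Areg; exact: near_signs.
move=> [gl sg].
pose path (t : R) := contraction l0 (l, t).
have cpath : connected (path @` `[0, 1]%classic).
  apply: connected_continuous_connected; first exact: segment_connected.
  apply: continuous_subspaceT => t.
  apply: (@cvg_comp _ _ _ (fun t : R => (l, t)) (contraction l0) _
    (nbhs (l, t))).
    exact: (@cvg_pair _ _ _ (nbhs t) (nbhs l) (nbhs t) _ _ _ (fun=> l) id
      (cvg_cst l) cvg_id).
  exact: contraction_continuous.
apply: (connected_component_max _ _ cpath).
- exists 1; first by rewrite /= in_itv /= ler01 lexx.
  exact: contraction1.
- move=> _ [t + <-]; rewrite /= in_itv /= => t01.
  by have [] := contraction_stratum t01 g0 gl sg.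
- by exists 0; [rewrite /= in_itv /= lexx ler01|exact: contraction0].
Qed.

Lemma contractible_component l0 : regular l0 ->
  contractible R (connected_component [set l | regular l] l0).
Proof.
move=> g0; rewrite componentE//.
exists l0, (contraction l0); split.
- by [].
- apply/subspace_continuousP => -[l t] [[gl _] _].
  apply: cvg_trans (contraction_continuous (l0 := l0) (t := t) gl).
  by apply: cvg_app; exact: cvg_within.
- by move=> l t [gl sg] t01; exact: contraction_stratum.
- by move=> l _; exact: contraction0.
- by move=> l [_ sg]; exact: contraction1.
Qed.

End Topology.

Theorem proposition1 (R : realType) (mu : nat) (hmu : (2 <= mu)%N) (s : bool)
    (f : 'rV[R]_mu -> R * R -> R)
    (hf : f = B_family s \/ f = C_family s)
    (l : 'rV[R]_mu) (hl : (~` discriminant f) l) :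
  contractible R (connected_component (~` discriminant f) l).
Proof.
(* for C_mu the parameters are multiplied by the sign of y^mu *)
have [e ee fe] : exists2 e : R, e * e = 1 &
    forall l', nonsingular f l' <-> simple_nonzero_roots (poly_of e l').
  case: hf => ->.
    by exists 1; [rewrite mulr1|exact: nonsingular_B].
  by exists ((-1) ^+ s); [rewrite -expr2 sqrr_sign|exact: nonsingular_C].
have E : ~` discriminant f = [set l' | simple_nonzero_roots (poly_of e l')].
  apply/seteqP; split=> l' /=.
    by move=> /contrapT; apply (fe l').1.
  by move=> g; apply; apply (fe l').2.
rewrite E in hl *.
exact: contractible_component.
Qed.
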